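(* Let $\mathfrak A\in K_{\overline\alpha}$ with $\delta(\mathfrak A)>0$. (1) If $\overline\alpha$ is not rational, then for every $\epsilon>0$ there are infinitely many pairwise non-isomorphic $\mathfrak D\in K_{\overline\alpha}$ such that $(\mathfrak A,\mathfrak D)$ is an essential minimal pair with $-\epsilon<\delta(\mathfrak D/\mathfrak A)<0$. (2) If $\overline\alpha$ is rational, then there are infinitely many pairwise non-isomorphic $\mathfrak D\in K_{\overline\alpha}$ such that $(\mathfrak A,\mathfrak D)$ is an essential minimal pair with $\delta(\mathfrak D/\mathfrak A)=-1/c$.
   Context: Fix a finite relational language $L$ in which every relation symbol has arity at least $2$. $K_L$ is the class of all finite $L$-structures (including the empty one) in which every relation symbol is interpreted symmetrically and irreflexively. Fix $\overline\alpha:L\to(0,1]$, writing $\overline\alpha_E=\overline\alpha(E)$, such that it is not the case that all symbols of $L$ are binary and $\overline\alpha_E=1$ for all $E$. For $\mathfrak A\in K_L$ let $N_E(\mathfrak A)$ be the number of subsets of $A$ on which $E$ holds and $\delta(\mathfrak A)=|A|-\sum_{E}\overline\alpha_E N_E(\mathfrak A)$. $K_{\overline\alpha}=\{\mathfrak A\in K_L:\delta(\mathfrak A')\ge0\text{ for all substructures }\mathfrak A'\subseteq\mathfrak A\}$. Subsets are identified with induced substructures; for $\mathfrak A\subseteq \mathfrak D$, $\delta(\mathfrak D/\mathfrak A)=\delta(\mathfrak D)-\delta(\mathfrak A)$, and for substructures $X,Y$ of a structure, $\delta(X/Y)=\delta(X\cup Y)-\delta(Y)$. For $\mathfrak A\subseteq\mathfrak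 B$, $\mathfrak A\le\mathfrak B$ means $\delta(\mathfrak A)\le\delta(\mathfrak A')$ for all $\mathfrak A\subseteq\mathfrak A'\subseteq\mathfrak B$; $(\mathfrak A,\mathfrak B)$ is a minimal pair if $\mathfrak A\subseteq\mathfrak B$, $\mathfrak A\le\mathfrak C$ for all $\mathfrak A\subseteq\mathfrak C\subsetneq\mathfrak B$, but $\mathfrak A\not\le\mathfrak B$. For $\mathfrak B\in K_{\overline\alpha}$ with $\delta(\mathfrak B)>0$, a structure $\mathfrak D\in K_{\overline\alpha}$ with $\mathfrak B\subseteq\mathfrak D$ forms an essential minimal pair $(\mathfrak B,\mathfrak D)$ if $(\mathfrak B,\mathfrak D)$ is a minimal pair and $\delta(\mathfrak D'/\mathfrak D'\cap\mathfrak B)\ge0$ for every substructure $\mathfrak D'\subsetneq\mathfrak D$. $\overline\alpha$ is rational if each $\overline\alpha_E$ is rational; in that case write $\overline\alpha_E=p_E/q_E$ in lowest terms and $c=\mathrm{lcm}\{q_E:E\in L\}$. *)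

(* Defs.v *)
From HB Require Import structures.
From mathcomp Require Import all_boot all_order all_algebra.
From mathcomp Require Import reals.
Set Implicit Arguments.
Unset Strict Implicit.
Unset Printing Implicit Defensive.
Import Order.TTheory GRing.Theory Num.Theory.
Local Open Scope ring_scope.

Section Hrushovski.
Variable L : finType.

(* A finite L-structure with universe 'I_sz.  Since every relation is
   symmetric and irreflexive, a relation symbol E is interpreted by the set
   of (ar E)-element subsets of the universe on which it holds. *)
Record struct := Struct { sz : nat; rels : L -> {set {set 'I_sz}} }.

Definition wf (ar : L -> nat) (D : struct) : Prop :=
  forall (E : L) (S : {set 'I_(sz D)}), S \in rels D E -> #|S| = ar E.

Definition NE (D : struct) (E : L) (X : {set 'I_(sz D)}) : nat :=
  #|[set S in rels D E | S \subset X]|.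

Variable R : realType.
Variable alpha : L -> R.

Definition delta (D : struct) (X : {set 'I_(sz D)}) : R :=
  (#|X|%:R) - \sum_(E : L) alpha E * (NE E X)%:R.

Definition delta_rel (D : struct) (X Y : {set 'I_(sz D)}) : R :=
  delta (X :|: Y) - delta Y.

Definition inK (D : struct) : Prop :=
  forall X : {set 'I_(sz D)}, 0 <= delta X.

Definition strong (D : struct) (B C : {set 'I_(sz D)}) : Prop :=
  B \subset C /\
  forall X : {set 'I_(sz D)}, B \subset X -> X \subset C -> delta B <= delta X.

Definition minimal_pair (D : struct) (B C : {set 'I_(sz D)}) : Prop :=
  [/\ B \subset C,
      (forall C' : {set 'I_(sz D)}, B \subset C' -> C' \proper C -> strong B C')
    & ~ strong B C].

Definition essential_minimal_pair (D : struct) (B : {set 'I_(sz D)}) : Prop :=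
  [/\ inK D, 0 < delta B, minimal_pair B setT
    & forall D' : {set 'I_(sz D)}, D' \proper setT -> 0 <= delta_rel D' (D' :&: B)].

End Hrushovski.

Definition embedding (L : finType) (A D : struct L) (f : 'I_(sz A) -> 'I_(sz D)) : Prop :=
  injective f /\
  forall (E : L) (S : {set 'I_(sz A)}), (S \in rels A E) = (f @: S \in rels D E).

Definition isomorphic (L : finType) (D1 D2 : struct L) : Prop :=
  exists f : 'I_(sz D1) -> 'I_(sz D2), bijective f /\
    forall (E : L) (S : {set 'I_(sz D1)}), (S \in rels D1 E) = (f @: S \in rels D2 E).

Definition rational_weights (L : finType) (R : realType) (alpha : L -> R) : Prop :=
  forall E : L, exists q : rat, alpha E = ratr q.

Definition denom_lcm (L : finType) (q : L -> rat) : nat :=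
  \big[lcmn/1%N]_(E : L) `|denq (q E)|%N.

(* Main.v *)
(** Add n new points b_0, ..., b_(n-1) to A, together with m new edges of total
    weight n + eta, where eta is the wanted drop of delta.  Lay the edges one
    after the other as intervals of length alpha on [0, n + eta], where b_0 owns
    [0, 1 + eta) and b_i owns [i + eta, i + 1 + eta).  An edge contains the
    point b_i owning its left end, and also b_(i+1) if it reaches the next
    owner's interval.  If no edge starts strictly between i and i + eta, then
    the surplus eta of b_0 can be passed on along these crossing edges to any
    b_j, so any set of new points missing some b_j is not overloaded.  The
    remaining vertices of the edges are free; they are used to make the edges
    distinct and to have every point of A in some new edge, which leaves X = D
    as the only set with delta(X / X :&: A) < 0.  In the rational case Bezout's
    identity gives total weight n + 1/c, and all left ends are multiples of 1/c;
    in the irrational case only one symbol, of irrational weight x, is used, and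
    m is the least number for which m x has fractional part below epsilon. *)

From HB Require Import structures.
From mathcomp Require Import all_boot all_order all_algebra.
From mathcomp Require Import boolp reals zify ring lra.
Require Import Defs.
Set Implicit Arguments.
Unset Strict Implicit.
Unset Printing Implicit Defensive.
Import Order.TTheory GRing.Theory Num.Theory.
Local Open Scope ring_scope.

(** * Schedules: edges as consecutive intervals *)

Section Schedule.
Variables (R : realType) (a : nat -> R) (eta : R).

Definition psum (k : nat) : R := \sum_(i < k) a i.

(* The index of the new point owning the left end of edge [k]; [truncn] sends
   the negative value [- eta], attained at [k = 0], to [0]. *)
Definition owner (k : nat) : nat := Num.truncn (psum k - eta).

Hypotheses (eta_gt0 : 0 < eta) (a_itv : forall k, eta <= a k <= 1).

Lemma psumS k : psum k.+1 = psum k + a k.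
Proof. by rewrite /psum big_ord_recr. Qed.

Lemma psum0 : psum 0 = 0.
Proof. by rewrite /psum big_ord0. Qed.

Lemma eta_le_psumS k : eta <= psum k.+1.
Proof.
elim: k => [|k IH]; have /andP[h _] := a_itv 0.
  by rewrite psumS psum0 add0r.
have /andP[h' _] := a_itv k.+1.
by rewrite psumS; move: eta_gt0 IH h'; lra.
Qed.

Lemma owner_le k : (owner k.+1)%:R <= psum k.+1 - eta.
Proof. by rewrite truncn_le subr_ge0 eta_le_psumS. Qed.

Lemma lt_ownerS k : psum k - eta < (owner k)%:R + 1.
Proof. by have := truncnS_gt (psum k - eta); rewrite -natr1. Qed.

Lemma owner0 : owner 0 = 0%N.
Proof. by rewrite /owner psum0 truncEfloor; apply/eqP; rewrite -truncEfloor -leqn0 truncn_le_nat; move: eta_gt0; lra. Qed.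

Lemma owner_mono : {homo owner : k l / (k <= l)%N}.
Proof.
apply: homo_leq => [//|? ? ?|k]; first exact: leq_trans.
apply: le_truncn; have /andP[h _] := a_itv k.
by rewrite psumS; move: eta_gt0; lra.
Qed.

Lemma owner_step k : (owner k.+1 <= (owner k).+1)%N.
Proof.
rewrite truncn_le_nat psumS; have := lt_ownerS k; have /andP[_ h] := a_itv k.
by rewrite -!natr1; lra.
Qed.

(** Owners are nondecreasing, so only the last edge of an owner can cross to the next one. *)
Lemma owner_crossing_inj k l : owner k = owner l ->
  owner k.+1 <> owner k -> owner l.+1 <> owner l -> k = l.
Proof.
move=> e hk hl; case: (ltngtP k l) => // h.
  by have := owner_mono h; have := owner_mono (leqnSn k); lia.
by have := owner_mono h; have := owner_mono (leqnSn l); lia.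
Qed.

Lemma psum_ge (x : R) k l : (forall i, x <= a i) -> psum k + l%:R * x <= psum (k + l).
Proof.
move=> hx; elim: l => [|l IH]; first by rewrite mul0r addr0 addn0.
by rewrite addnS psumS -natr1 mulrDl mul1r; have := hx (k + l)%N; lra.
Qed.

(** Any [d] consecutive edges have total length at least 2, while the left ends belonging to one
    owner lie in a half-open interval of length at most [1 + eta <= 2]. *)
Lemma owner_window (x : R) d k l : 0 <= x -> (forall i, x <= a i) -> 2 <= d%:R * x ->
  owner k = owner l -> (l < k + d)%N.
Proof.
move=> x0 hx hd e; rewrite ltnNge; apply/negP => h.
have e1 : 1 <= a 0 + 1 - eta by have /andP[] := a_itv 0; lra.
have := psum_ge k d hx.
have : psum (k + d) <= psum l.
  rewrite -(subnKC h); have := psum_ge (k + d) (l - (k + d)) hx.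
  by have : 0 <= (l - (k + d))%:R * x; [rewrite mulr_ge0|lra].
have h1 := lt_ownerS l; rewrite -e in h1.
have : eta <= 1 by have /andP[] := a_itv 0; lra.
case: k => [|k] in h e h1 *.
  by rewrite owner0 psum0 in h1 *; lra.
have := owner_le k; lra.
Qed.

Variables (n m : nat).
Hypotheses (n_gt0 : (0 < n)%N) (psum_m : psum m = n%:R + eta)
  (gap : forall k i : nat, (k < m)%N -> ~~ (i%:R < psum k < i%:R + eta)).

Lemma owner_m : owner m = n.
Proof. by rewrite /owner psum_m addrK natrK. Qed.

Lemma psum_lt k : (k < m)%N -> psum k < psum m.
Proof.
move=> km; have := psum_ge k (m - k) (fun i => proj1 (andP (a_itv i))).
rewrite subnKC 1?ltnW//; suff : 0 < (m - k)%:R * eta by lra.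
by rewrite mulr_gt0 // ltr0n subn_gt0.
Qed.

Lemma owner_lt k : (k < m)%N -> (owner k < n)%N.
Proof.
move=> km; have := psum_lt km; rewrite psum_m => h.
case: k km h => [|k] km h; first by rewrite owner0.
by have := owner_le k; rewrite -(ltr_nat R); lra.
Qed.

(** [gap] sharpens the bound of [lt_ownerS] by [eta]. Hence a crossing edge covers the whole stretch
    from [i] to [i + eta], where [i] is the next owner, and can carry the surplus. *)
Lemma psum_le_ownerS k : (k < m)%N -> psum k <= (owner k)%:R + 1.
Proof.
move=> km; rewrite leNgt; apply/negP => h.
have /negP[] := gap (owner k).+1 km.
by rewrite -natr1 h /=; have := lt_ownerS k; lra.
Qed.

(* [Y] is a set of new points, the dummy index [n] included. *)
Lemma counted_weight_le (Y counted : pred nat) :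
  Y n -> (exists2 i, (i < n)%N & ~~ Y i) ->
  (forall k, (k < m)%N -> counted k -> Y (owner k) && Y (owner k.+1)) ->
  \sum_(k < m | counted k) a k <= (\sum_(i < n) Y i)%N%:R.
Proof.
move=> Yn [i0 i0n Yi0] hc.
pose full i := [forall j : 'I_i.+1, Y j].
have fullS i : full i.+1 = full i && Y i.+1.
  apply/forallP/andP => [h|[/forallP h1 h2] j].
    split; last exact: (h ord_max).
    by apply/forallP => j; exact: (h (widen_ord (leqnSn _) j)).
  have [/= j' |jl] := unliftP ord_max j; last by rewrite jl.
  by move=> ->; rewrite lift_max.
(* The part of the interval of point [i] lying before [x], with the surplus
   [eta] still to be paid as long as no point up to [i] is missing. *)
pose pot i (x : R) := if Y i then x - i%:R - eta + (if full i then eta else 0) else 0.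
suff H k : (k <= m)%N -> \sum_(j < k | counted j) a j
    <= (\sum_(i < owner k) Y i)%N%:R + pot (owner k) (psum k).
  (* At [k = m] the potential is 0: the owner is [n], which lies in [Y], and [full n] fails because
     of [i0]. *)
  have := H m (leqnn m); rewrite owner_m /pot Yn psum_m.
  case: ifP => [/forallP/(_ (widen_ord (leqnSn _) (Ordinal i0n)))/=|_]; last lra.
  by rewrite (negPf Yi0).
elim: k => [_|k IH km].
  rewrite big_ord0 owner0 big_ord0 /pot psum0 add0r.
  case: ifP => // Y0; case: ifP => [|/negP[]]; first lra.
  by apply/forallP => j; rewrite ord1.
have {}IH := IH (ltnW km).
rewrite big_mkcond big_ord_recr/= -big_mkcond/= psumS.
have := owner_step k; have := owner_mono (leqnSn k).
have /andP[ak1 ak2] := a_itv k.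
have := hc k km; have p1 := psum_le_ownerS km; have := owner_le k; rewrite psumS.
case: (ltngtP (owner k.+1) (owner k).+1) => // h; last first.
  rewrite h big_ord_recr/= natrD -!natr1 => p2 {}hc _ _.
  rewrite /pot fullS -!natr1 in IH *.
  case: (counted k) hc => [/(_ isT)/andP[Y1 Y2]|_].
    by rewrite Y1 Y2 andbT in IH *; move: IH; case: ifP => _ /=; lra.
  (* An uncounted crossing edge may lead from a point of [Y] to one outside. The lost potential, at
     most 1 by [p1], is then covered by the unit of the point just left. *)
  by move: IH; case: (Y (owner k)); case: (Y (owner k).+1); case: (full (owner k)) => /=; move: eta_gt0; lra.
move=> p2 {}hc h1 _; have {h h1} e : owner k.+1 = owner k by lia.
rewrite e in p2 hc *; move: IH hc; rewrite /pot.
by case: (Y (owner k)); case: (counted k) => /=; case: (full (owner k)) => IH hc; first [by have := hc isT | move: IH eta_gt0; lra].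
Qed.
End Schedule.

(** * Adding points and edges to A *)

Section Extension.
Variables (L : finType) (A : struct L) (n m : nat) (t : nat -> L)
  (S : 'I_m -> {set 'I_(n + sz A)}).

Definition extension : struct L :=
  @Struct L (n + sz A) (fun E =>
    [set @rshift n (sz A) @: T | T : {set 'I_(sz A)} in rels A E]
      :|: S @: [set k : 'I_m | t k == E]).

Let old (i : 'I_(sz A)) : 'I_(sz extension) := rshift n i.
Let new (i : 'I_n) : 'I_(sz extension) := lshift (sz A) i.

Hypothesis S_new : forall k, exists i, new i \in S k.
Hypothesis S_inj : forall k l : 'I_m, t k = t l -> S k = S l -> k = l.

Let old_inj : injective old. Proof. exact: rshift_inj. Qed.

Lemma new_edge_not_old k (X : {set 'I_(sz A)}) : (S k \subset old @: X) = false.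
Proof.
apply/negP => /subsetP h; have [i /h /imsetP[j _ /eqP]] := S_new k.
by rewrite eq_lrshift.
Qed.

Lemma extension_wf (ar : L -> nat) :
  wf ar A -> (forall k : 'I_m, #|S k| = ar (t k)) -> wf ar extension.
Proof.
move=> wA hS E X /setUP[/imsetP[T /wA <- ->]|/imsetP[k]].
  exact/card_imset/old_inj.
by rewrite inE => /eqP <- ->.
Qed.

Lemma extension_embedding : @embedding L A extension old.
Proof.
split=> // E X; apply/idP/setUP => [XE|[/imsetP[T TE]|/imsetP[k _ e]]].
- by left; apply/imsetP; exists X.
- by move/(imset_inj old_inj) => ->.
- by have := new_edge_not_old k X; rewrite e subxx.
Qed.

Section Weighted.
Variables (R : realType) (alpha : L -> R).

Lemma extension_NE E (X : {set 'I_(sz extension)}) :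
  NE E X = (@NE L A E (old @^-1: X) + \sum_(k < m | S k \subset X) (t k == E))%N.
Proof.
rewrite /NE setIdE setIUl -!setIdE cardsU.
have -> : [set T in [set old @: U | U : {set 'I_(sz A)} in rels A E] | T \subset X]
    = [set old @: T | T : {set 'I_(sz A)} in [set T in rels A E | T \subset old @^-1: X]].
  apply/setP => T; rewrite !inE; apply/andP/imsetP => [[/imsetP[U UE ->] UX]|[U]].
    by exists U; rewrite // inE UE sub_imset_pre in UX *.
  by rewrite inE -sub_imset_pre => /andP[UE UX] ->; rewrite imset_f.
have -> : [set T in S @: [set k : 'I_m | t k == E] | T \subset X]
    = S @: [set k : 'I_m | (S k \subset X) && (t k == E)].
  apply/setP => T; rewrite !inE; apply/andP/imsetP => [[/imsetP[k kE ->] kX]|[k]].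
    by exists k; rewrite // !inE kX in kE *.
  by rewrite inE => /andP[kX kE ->]; rewrite imset_f // inE.
rewrite (card_imset _ (imset_inj old_inj)) card_in_imset; last first.
  by move=> k l; rewrite !inE => /andP[_ /eqP <-] /andP[_ /eqP kl]; exact: S_inj.
rewrite (_ : _ :&: _ = set0) ?cards0 ?subn0; last first.
  apply/setP => T; rewrite !inE; apply/negP => /andP[/imsetP[U _ ->] /imsetP[k _ e]].
  by have := new_edge_not_old k U; rewrite e subxx.
congr (_ + _)%N; rewrite -sum1dep_card big_mkcondr.
by apply: eq_bigr => k _; case: (t k == E).
Qed.

Lemma extension_delta (X : {set 'I_(sz extension)}) :
  delta alpha X = @delta L R alpha A (old @^-1: X) + #|new @^-1: X|%:R
    - \sum_(k < m | S k \subset X) alpha (t k).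
Proof.
rewrite /delta.
have -> : #|X| = (#|old @^-1: X| + #|new @^-1: X|)%N.
  rewrite -sum1_card big_split_ord /= addnC; congr (_ + _)%N.
    by rewrite -sum1_card; apply: eq_bigl => i; rewrite inE.
  by rewrite -sum1_card; apply: eq_bigl => i; rewrite inE.
suff -> : \sum_E alpha E * (NE E X)%:R = \sum_E alpha E * (@NE L A E (old @^-1: X))%:R
    + \sum_(k < m | S k \subset X) alpha (t k) by rewrite natrD; ring.
under eq_bigr => E _ do rewrite extension_NE natrD mulrDr.
rewrite big_split /=; congr (_ + _).
under eq_bigr => E _ do rewrite natr_sum mulr_sumr.
rewrite exchange_big; apply: eq_bigr => k _ /=.
rewrite (bigD1 (t k)) //= eqxx mulr1 big1 ?addr0 // => E /negPf.
by rewrite eq_sym => ->; rewrite mulr0.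
Qed.

Lemma delta_old (X : {set 'I_(sz A)}) :
  @delta L R alpha extension (old @: X) = delta alpha X.
Proof.
rewrite extension_delta big_pred0 => [|k]; last exact: new_edge_not_old.
rewrite (_ : new @^-1: _ = set0) ?cards0 ?addr0 ?subr0; last first.
  apply/setP => i; rewrite !inE; apply/negP => /imsetP[j _ /eqP].
  by rewrite eq_lrshift.
congr (delta _ _); apply/setP => i; rewrite inE; exact: mem_imset.
Qed.

Lemma deltaT_extension :
  @delta L R alpha extension setT - @delta L R alpha extension (old @: setT)
    = n%:R - \sum_(k < m) alpha (t k).
Proof.
rewrite delta_old extension_delta !preimsetT cardsT card_ord.
by under eq_bigl => k do rewrite subsetT; ring.
Qed.

(** Relative to its part in A, a set X has [delta] equal to the number of its new points minus the
    weight of the new edges inside it. For proper X the last hypothesis makes this nonnegative,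
    which gives all conditions except those on D itself. *)
Lemma extension_essential :
  inK alpha A -> 0 < @delta L R alpha A setT ->
  0 <= @delta L R alpha extension setT ->
  \sum_(k < m) alpha (t k) > n%:R ->
  (forall X : {set 'I_(sz extension)}, X \proper setT ->
     \sum_(k < m | S k \subset X) alpha (t k) <= #|new @^-1: X|%:R) ->
  @essential_minimal_pair L R alpha extension (old @: setT).
Proof.
move=> AK Apos Dge0 Wgt Xle.
have capE (X : {set 'I_(sz extension)}) : X :&: old @: setT = old @: (old @^-1: X).
  apply/setP => x; rewrite inE; apply/andP/imsetP => [[xX /imsetP[i _ e]]|[i]].
    by exists i; rewrite // inE -e.
  by rewrite inE => iX ->; rewrite iX imset_f.
have core (X : {set 'I_(sz extension)}) : X \proper setT ->
    @delta L R alpha extension (X :&: old @: setT) <= @delta L R alpha extension X.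
  by move=> /Xle h; rewrite capE delta_old (extension_delta X); lra.
split.
- move=> X; have [->//|XT] := eqVneq X setT.
  have XT' : X \proper setT by rewrite properT.
  by apply: le_trans (core X XT'); rewrite capE delta_old.
- by rewrite delta_old.
- split=> [|C sC pC|[_ /(_ setT)]]; first exact: subsetT.
    split=> // X sX XC; have := core X (sub_proper_trans XC pC).
    by rewrite (setIidPr sX).
  by move=> /(_ (subsetT _) (subsetT _)); have := deltaT_extension; lra.
- move=> X pX; rewrite /delta_rel (setUidPl _) ?subsetIl // subr_ge0.
  exact: core.
Qed.
End Weighted.
End Extension.

(** * Choosing the vertices of the edges *)

Lemma card_set_mem_seq N (s : seq nat) : uniq s -> all (fun x => x < N)%N s ->
  #|[set x : 'I_N | val x \in s]| = size s.
Proof.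
move=> us sN; have e : map val (pmap (insub : nat -> option 'I_N) s) = s.
  rewrite (pmap_filter (@insubK _ _ _)); apply/all_filterP.
  by apply: sub_all sN => x xN; rewrite /= insubT.
rewrite -{2}e size_map -(card_uniqP _) ?(pmap_sub_uniq _ us) //.
by apply: eq_card => x; rewrite inE mem_pmap_sub.
Qed.

(* Below, [r k] is the arity of edge [k] and [w k] its owner; the new points are
   [0 .. n - 1] and the points of A are [n .. n + a - 1].  An edge of arity [r] is
   a block of [r - 1] consecutive points plus one point beyond it, hence is
   determined by its minimum [lo] and maximum [hi].  If [o k < a], edge [k] is
   made to contain the [o k]-th point of A; otherwise the difference [hi - lo]
   is at most [r - 1 + d] for the edges extending upwards and larger for
   the edges of the last owners, which extend downwards. *)
Section EdgePlacement.
Variables (n a m rmax d : nat) (r w o : nat -> nat).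

Definition crossing k := w k.+1 != w k.
(** Edges with [o k < a] will have [hi - lo] above this number, all others below it. *)
Definition slack : nat := (rmax + 2 * d + 2)%N.

(* [k %% d] tells apart the edges with the same owner, as there are at most [d]. *)
Let shift k := if crossing k then 0%N else (k %% d).+1.

(** A binary crossing edge is forced to be the pair [w k], [w k + 1], so it counts as upward
    wherever it lies. For larger arity a block ending at [w k + 1] contains both owners. *)
Let up k := [|| (o k < a)%N, (w k + slack < n)%N | (r k == 2%N) && crossing k].

Let hi k := if (o k < a)%N then (n + o k)%N
  else if up k then (w k + (r k).-1 + shift k)%N else (w k + (2 < r k))%N.

Let lo k := if up k then w k else (hi k - ((r k).-1 + d.+1 + shift k))%N.

Definition edge_points k : seq nat :=
  if up k then hi k :: iota (lo k) (r k).-1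
  else lo k :: iota (hi k - (r k).-2) (r k).-1.

Definition edge_set k : {set 'I_(n + a)} := [set x | val x \in edge_points k].

Hypotheses (a_gt0 : (0 < a)%N) (d_gt0 : (0 < d)%N) (n_big : (2 * slack <= n)%N)
  (r_itv : forall k, (2 <= r k <= rmax)%N)
  (w_lt : forall k, (k < m)%N -> (w k < n)%N)
  (w_window : forall k l, w k = w l -> (l < k + d)%N)
  (w_crossing_inj : forall k l, w k = w l -> crossing k -> crossing l -> k = l)
  (o_ok : forall k, (k < m)%N -> (o k < a)%N ->
     (w k + slack < n)%N && ((2 < r k)%N || ~~ crossing k))
  (o_inj : forall k l, (k < m)%N -> (l < m)%N -> (o k < a)%N ->
     w k = w l -> o k = o l -> k = l).

Let shift_le k : (shift k <= d)%N.
Proof. by rewrite /shift; case: ifP => // _; rewrite ltn_mod. Qed.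

Let shift_inj k l : w k = w l -> shift k = shift l -> k = l.
Proof.
move=> e; rewrite /shift; case: ifP => ck; case: ifP => cl //.
  by move=> _; exact: w_crossing_inj.
move=> [] h; have := w_window e; have := w_window (esym e).
wlog kl : k l {e ck cl} h / (k <= l)%N => [H|h1 h2].
  by case/orP: (leq_total k l) => kl h1 h2; [|apply/esym]; apply: H.
have : (l - k = 0 %[mod d])%N.
  by apply/eqP; rewrite mod0n -/(dvdn d _) -eqn_mod_dvd // h.
by rewrite mod0n modn_small; lia.
Qed.

(** Near the end [hi k] may be [n], the first point of A standing for the dummy owner; hence the
    need for [0 < a]. *)
Let lo_hi k : (k < m)%N -> (lo k + (r k).-1 <= hi k < n + a)%N.
Proof.
move=> km; have := shift_le k; have := r_itv k; have := w_lt km; have := o_ok km.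
have c0 : crossing k -> shift k = 0%N by rewrite /shift => ->.
move: n_big c0; rewrite /lo /hi /up /slack.
case: (ltnP (o k) a) => /= ok; case: (ltnP (w k + _)) => /= wk;
  case: (crossing k); case: (r k == 2%N) / eqP => /= rk; lia.
Qed.

Let lo_mem k : (k < m)%N -> lo k \in edge_points k.
Proof.
move=> km; have := lo_hi km; have := r_itv k.
by rewrite /edge_points; case: (up k); rewrite inE ?mem_iota; lia.
Qed.

Let hi_mem k : (k < m)%N -> hi k \in edge_points k.
Proof.
move=> km; have := lo_hi km; have := r_itv k.
by rewrite /edge_points; case: (up k); rewrite inE ?mem_iota; lia.
Qed.

Let points_itv k x : (k < m)%N -> x \in edge_points k -> (lo k <= x <= hi k)%N.
Proof.
move=> km; have := lo_hi km; have := r_itv k.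
by rewrite /edge_points; case: (up k); rewrite inE ?mem_iota; lia.
Qed.

Lemma card_edge_set k : (k < m)%N -> #|edge_set k| = r k.
Proof.
move=> km; have rk := r_itv k; have lh := lo_hi km.
rewrite card_set_mem_seq.
- by rewrite /edge_points; case: (up k); rewrite /= size_iota; lia.
- by rewrite /edge_points; case: (up k); rewrite /= iota_uniq mem_iota; lia.
- by apply/allP => x /(points_itv km); lia.
Qed.

Lemma owner_edge_set (k : nat) (x : 'I_(n + a)) :
  (k < m)%N -> val x = w k -> x \in edge_set k.
Proof.
move=> km e; rewrite inE e /edge_points; have := lo_hi km; have := r_itv k.
have := o_ok km.
rewrite /lo /hi /up; case: (ltnP (o k) a) => /= ok; case: (ltnP (w k + _)) => /= wk;
  case: (crossing k); case: (r k == 2%N) / eqP => /=; rewrite inE mem_iota; lia.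
Qed.

Lemma owner_succ_edge_set (k : nat) (x : 'I_(n + a)) :
  (k < m)%N -> crossing k -> val x = (w k).+1 -> x \in edge_set k.
Proof.
move=> km ck e; rewrite inE e /edge_points; have := lo_hi km; have := r_itv k.
have := o_ok km; have c0 : shift k = 0%N by rewrite /shift ck.
rewrite /lo /hi /up c0 ck; case: (ltnP (o k) a) => /= ok; case: (ltnP (w k + _)) => /= wk;
  case: (r k == 2%N) / eqP => /=; rewrite inE mem_iota; lia.
Qed.

Lemma override_edge_set (k : nat) (x : 'I_(n + a)) :
  (o k < a)%N -> val x = (n + o k)%N -> x \in edge_set k.
Proof. by move=> ok e; rewrite inE e /edge_points /up ok /hi ok inE eqxx. Qed.

(** The set determines [lo] and [hi]. Given the arity, their difference tells which of the three
    placements was used, and the placement gives back the owner together with [o] or [shift]. *)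
Lemma edge_set_inj k l : (k < m)%N -> (l < m)%N -> r k = r l ->
  edge_set k = edge_set l -> k = l.
Proof.
move=> km lm rkl e.
have sub x k' l' : (k' < m)%N -> edge_set k' = edge_set l' ->
    x \in edge_points k' -> x \in edge_points l'.
  move=> k'm e' xk; have xna : (x < n + a)%N.
    by have := points_itv k'm xk; have := lo_hi k'm; lia.
  by have := in_set (fun x : 'I_(n + a) => val x \in edge_points k') (Ordinal xna);
    rewrite -/(edge_set k') e' inE /= xk.
have elo : lo k = lo l.
  have /(points_itv lm) := sub _ _ _ km e (lo_mem km).
  by have /(points_itv km) := sub _ _ _ lm (esym e) (lo_mem lm); lia.
have ehi : hi k = hi l.
  have /(points_itv lm) := sub _ _ _ km e (hi_mem km).
  by have /(points_itv km) := sub _ _ _ lm (esym e) (hi_mem lm); lia.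
have lhk := lo_hi km; have lhl := lo_hi lm.
suff [we H] : w k = w l /\ ((o k < a)%N /\ o k = o l \/ shift k = shift l).
  by case: H => [[ok oe]|se]; [exact: o_inj|exact: shift_inj].
move: lhk lhl elo ehi (o_ok km) (o_ok lm) (r_itv k) (shift_le k) (shift_le l) (w_lt km) (w_lt lm) n_big.
have c0 i : crossing i -> shift i = 0%N by rewrite /shift => ->.
have c1 i : ~~ crossing i -> (0 < shift i)%N by rewrite /shift => /negPf ->.
move: (c0 k) (c0 l) (c1 k) (c1 l); rewrite /lo /hi /up -rkl /slack.
move: (shift k) (shift l) => sk sl.
case: (ltnP (o k) a) => ok; case: (ltnP (o l) a) => ol /=;
  case: (ltnP (w k + _)) => wk /=; case: (ltnP (w l + _)) => wl /=;
  case: (crossing k); case: (crossing l); case: (r k == 2%N) / eqP => rk2 /=; lia.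
Qed.
End EdgePlacement.

(** * The extension attached to a schedule *)

Section Construction.
Variables (R : realType) (L : finType) (ar : L -> nat) (alpha : L -> R) (A : struct L).
Hypotheses (ar_ge2 : forall E : L, (2 <= ar E)%N)
  (alpha_itv : forall E : L, 0 < alpha E <= 1)
  (A_wf : wf ar A) (A_K : inK alpha A)
  (A_pos : 0 < delta alpha (setT : {set 'I_(sz A)})).

Let a := sz A.

Lemma sz_gt0 : (0 < a)%N.
Proof.
rewrite lt0n; apply/negP => /eqP a0; move: A_pos; apply/negP; rewrite -leNgt /delta.
have c0 : (sz A)%:R = 0 :> R by rewrite -/a a0.
rewrite cardsT card_ord c0 sub0r oppr_le0 sumr_ge0 // => E _.
by rewrite mulr_ge0 //; case/andP: (alpha_itv E) => /ltW.
Qed.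

Variables (eta : R) (n m d K : nat) (t : nat -> L) (E0 : L).
Let wt k := alpha (t k).
Let w := owner wt eta.
Let rmax := (\max_E ar E)%N.

Hypotheses (eta_gt0 : 0 < eta) (eta_le : forall k, eta <= wt k)
  (eta_le_delta : eta <= delta alpha (setT : {set 'I_(sz A)}))
  (psum_m : psum wt m = n%:R + eta)
  (gap : forall k i : nat, (k < m)%N -> ~~ (i%:R < psum wt k < i%:R + eta))
  (d_big : forall E, 2 <= d%:R * alpha E)
  (n_big : (K + 2 * slack rmax d <= n)%N)
  (t_E0 : forall k, (k < K)%N -> t k = E0)
  (E0_special : (2 < ar E0)%N \/ alpha E0 < 1)
  (K_ge : (a <= K)%N) (K_big : alpha E0 < 1 -> a%:R <= K%:R * (1 - alpha E0)).

Let wt_itv k : eta <= wt k <= 1.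
Proof. by rewrite eta_le; case/andP: (alpha_itv (t k)). Qed.

Let n_gt0 : (0 < n)%N.
Proof. by move: n_big; rewrite /slack; lia. Qed.

Let w_le k : (w k <= k)%N.
Proof.
elim: k => [|k IH]; first by rewrite /w owner0.
by have := owner_step wt_itv k; rewrite -/w; lia.
Qed.

Let K_lt : (K < m)%N.
Proof.
have := w_le m; rewrite /w (@owner_m _ _ _ n) //.
by move: n_big; rewrite /slack; lia.
Qed.

(* If [E0] has arity at least 3, edge [k] takes care of the [k]-th point of A;
   otherwise the [c]-th non-crossing edge takes care of the [c]-th point, and
   [k - w k] counts the non-crossing edges before edge [k]. *)
Lemma override_exists : exists o : nat -> nat,
  [/\ forall k, (o k < a)%N ->
        (w k + slack rmax d < n)%N && ((2 < ar (t k))%N || ~~ crossing w k),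
      forall k l, (o k < a)%N -> w k = w l -> o k = o l -> k = l
    & forall c, (c < a)%N -> exists2 k, (k < m)%N & o k = c].
Proof.
have sl k : (k < K)%N -> (w k + slack rmax d < n)%N.
  by have := w_le k; move: n_big; rewrite /slack; lia.
case: E0_special => [ar3|alpha1].
  exists id; split=> [k ka|//|c ca]; last by exists c => //; move: K_lt K_ge; lia.
  by rewrite sl ?t_E0 ?ar3 //; move: K_ge; lia.
exists (fun k => if ~~ crossing w k && (k < K)%N then (k - w k)%N else a).
split.
- move=> k; case: ifP => [/andP[nc kK] _|]; last by rewrite ltnn.
  by rewrite sl // nc orbT.
- move=> k l; case: ifP => _; last by rewrite ltnn.
  case: ifP => _ h e e2; last by move: h; rewrite e2 ltnn.
  by have := w_le k; have := w_le l; lia.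
(* Among the first [K] edges, all of weight [alpha E0], exactly [K - w K] do not cross. As
   [w K <= K * alpha E0], these are at least [a] by [K_big]. *)
- move=> c ca; have cK : (c < K - w K)%N.
    apply: leq_trans ca _; rewrite leq_subRL ?w_le // -(ler_nat R) natrD.
    have := K_big alpha1; suff : (w K)%:R <= K%:R * alpha E0 by lra.
    have psK k : (k <= K)%N -> psum wt k = k%:R * alpha E0.
      elim: k => [|k IH] kK; first by rewrite psum0 mul0r.
      by rewrite psumS IH 1?ltnW // /wt t_E0 // -natr1; ring.
    rewrite -psK //; case: (K) => [|k]; first by rewrite /w owner0 // psum0.
    by have := owner_le eta_gt0 wt_itv k; rewrite -/w; move: eta_gt0; lra.
  suff [k [kK nc e]] : exists k, [/\ (k < K)%N, ~~ crossing w k & (k - w k)%N = c].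
    by exists k; [exact: ltn_trans K_lt|rewrite nc kK e].
  (* [k - w k] grows by 1 at a non-crossing edge and is unchanged at a crossing one, so each value
     below the final one is taken at a non-crossing edge. *)
  elim: (K) cK => [|k IH]; first by rewrite sub0n.
  have st := owner_step wt_itv k; have mo := owner_mono eta_gt0 wt_itv (leqnSn k).
  move=> ck; case: (ltnP c (k - w k)) => [/IH[k' [k'k nc e]]|ck'].
    by exists k'; split=> //; exact: ltnW.
  exists k; split=> //.
    by rewrite /crossing negbK; apply/eqP; move: st mo; rewrite -/w; lia.
  by move: st mo; rewrite -/w; lia.
Qed.

Lemma extension_exists : exists D : struct L,
  [/\ sz D = (n + a)%N, wf ar D
    & exists f : 'I_(sz A) -> 'I_(sz D),
      [/\ embedding f, essential_minimal_pair alpha (f @: setT)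
        & delta alpha (setT : {set 'I_(sz D)}) - delta alpha (f @: setT) = - eta]].
Proof.
have [o [o_ok o_inj o_surj]] := override_exists.
pose r k := ar (t k).
have a0 := sz_gt0.
have d0 : (0 < d)%N.
  by rewrite lt0n; apply/negP => /eqP d0; have := d_big E0; rewrite d0; lra.
have n_big' : (2 * slack rmax d <= n)%N by move: n_big; lia.
have r_itv k : (2 <= r k <= rmax)%N by rewrite ar_ge2 /=; exact: leq_bigmax.
have w_lt k : (k < m)%N -> (w k < n)%N by exact: (owner_lt eta_gt0 wt_itv n_gt0 psum_m).
have w_win k l : w k = w l -> (l < k + d)%N.
  have [x [x0 xd xa]] : exists x : R, [/\ 0 <= x, 2 <= d%:R * x & forall E, x <= alpha E].
    have [E _ hE] := @Order.TotalTheory.arg_minP _ R L E0 predT alpha isT.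
    exists (alpha E); split=> //; first by case/andP: (alpha_itv E) => /ltW.
    by move=> E'; exact: hE.
  by move=> e; apply: (owner_window eta_gt0 wt_itv x0 _ xd e) => i; exact: xa.
have w_inj k l : w k = w l -> crossing w k -> crossing w l -> k = l.
  by move=> e /eqP h1 /eqP h2; exact: (owner_crossing_inj eta_gt0 wt_itv e h1 h2).
have o_ok' k : (k < m)%N -> (o k < a)%N ->
    (w k + slack rmax d < n)%N && ((2 < r k)%N || ~~ crossing w k).
  by move=> _; exact: o_ok.
have o_inj' k l : (k < m)%N -> (l < m)%N -> (o k < a)%N ->
     w k = w l -> o k = o l -> k = l by move=> _ _; exact: o_inj.
pose S (k : nat) := edge_set n a rmax d r w o k.
pose S' (k : 'I_m) : {set 'I_(n + sz A)} := S k.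
have S_new (k : 'I_m) : exists i : 'I_n, lshift (sz A) i \in S' k.
  exists (Ordinal (w_lt k (ltn_ord k))).
  by apply: (@owner_edge_set n a m rmax d r w o) => //.
have S_inj (k l : 'I_m) : t k = t l -> S' k = S' l -> k = l.
  move=> tkl e; apply/val_inj.
  have rkl : r k = r l by rewrite /r tkl.
  exact: (edge_set_inj a0 d0 n_big' r_itv w_lt w_win w_inj o_ok' o_inj' _ _ rkl e).
have S_card (k : 'I_m) : #|S' k| = ar (t k).
  by rewrite (@card_edge_set n a m rmax d r w o).
pose D := extension t S'; exists D; split=> //; first exact: extension_wf.
exists (fun i => rshift n i).
have wtot : \sum_(k < m) alpha (t k) = n%:R + eta by rewrite -psum_m.
have dT := deltaT_extension S_new S_inj alpha; rewrite wtot in dT.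
split; [exact: extension_embedding | | by rewrite dT; ring].
apply: extension_essential => //.
- by have := eta_le_delta; move: dT; rewrite delta_old //; lra.
- by rewrite wtot; have := eta_gt0; lra.
move=> X pX.
(* If X contains all new points, it misses some point [c] of A. The new edge through [c] is then not
   inside X, and its weight, at least [eta], is saved from the total [n + eta]. Otherwise X misses a
   new point and the schedule gives the bound. *)
have [allX|/subsetPn[x]] := boolP ([set: 'I_n] \subset lshift (sz A) @^-1: X).
  have [c cX] : exists c : 'I_a, rshift n c \notin X.
    move: pX; rewrite properT => /eqP XT; apply/existsP; rewrite -negb_forall.
    apply/negP => /forallP h; case: XT; apply/setP => x; rewrite inE.
    case: (split_ordP x) => j ->; last exact: h.
    by have := subsetP allX j; rewrite !inE; apply.
  have [k km e] := o_surj c (ltn_ord c).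
  have kX : ~~ (S' (Ordinal km) \subset X).
    apply/negP => /subsetP /(_ (rshift n c)); rewrite (negPf cX) => h.
    suff : false by []. apply: h.
    by apply: (@override_edge_set n a rmax d r w o); rewrite /= e.
  have -> : lshift (sz A) @^-1: X = setT by apply/eqP; rewrite eqEsubset subsetT.
  rewrite cardsT card_ord -[leRHS](addrK eta) -wtot [X in _ <= X - _](bigD1 (Ordinal km)) //=.
  have : \sum_(i < m | S' i \subset X) alpha (t i)
      <= \sum_(i < m | i != Ordinal km) alpha (t i).
    rewrite big_mkcond [leRHS]big_mkcond /=; apply: ler_sum => i _.
    have [->|_] := eqVneq i (Ordinal km); first by rewrite (negPf kX).
    by case: ifP => // _; case/andP: (alpha_itv (t i)) => /ltW.
  by have := eta_le k; rewrite /wt; lra.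
rewrite !inE => _ xX.
pose Y (i : nat) := [forall j : 'I_n, (val j == i) ==> (lshift (sz A) j \in X)].
have YE (i : 'I_n) : Y i = (lshift (sz A) i \in X).
  apply/forallP/idP => [/(_ i)/implyP/(_ (eqxx _))//|iX j].
  by apply/implyP => /eqP/val_inj ->.
have -> : #|lshift (sz A) @^-1: X| = (\sum_(i < n) Y i)%N.
  rewrite -sum1_card big_mkcond /=; apply: eq_bigr => i _.
  by rewrite inE YE; case: (lshift _ _ \in X).
apply: (counted_weight_le (counted := fun k => S k \subset X) eta_gt0 wt_itv n_gt0 psum_m gap).
(* The dummy index [n] lies in [Y] vacuously. *)
- by apply/forallP => j; rewrite /= ltn_eqF.
- by exists x; rewrite // YE.
move=> k km /subsetP kX; apply/andP; split; apply/forallP => j; apply/implyP => /eqP e.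
  by apply: kX; apply: (@owner_edge_set n a m rmax d r w o).
have [wk|wk] := eqVneq (w k.+1) (w k); apply: kX.
  by apply: (@owner_edge_set n a m rmax d r w o) => //; rewrite /= -wk.
apply: (@owner_succ_edge_set n a m rmax d r w o) => //=; rewrite e.
have := owner_step wt_itv k; have := owner_mono eta_gt0 wt_itv (leqnSn k).
by rewrite -/w => h1 h2; apply/eqP; rewrite eqn_leq h2 ltn_neqAle eq_sym wk.
Qed.
End Construction.

(** * Schedules for an irrational weight *)

Lemma psum_const (R : realType) (x : R) k : psum (fun=> x) k = k%:R * x.
Proof. by elim: k => [|k IH]; rewrite ?psum0 ?mul0r // psumS IH -natr1; ring. Qed.

Section IrrationalMultiples.
Variables (R : realType) (x : R).
Hypotheses (x_gt0 : 0 < x) (x_irr : forall q : rat, x <> ratr q).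

Let fr k : R := k%:R * x - (Num.truncn (k%:R * x))%:R.

Let kx_ge0 k : 0 <= k%:R * x.
Proof. by rewrite mulr_ge0 // ltW. Qed.

Lemma natmul_irrational_neq k l : (0 < k)%N -> k%:R * x <> l%:R.
Proof.
move=> k0 e; have k0' : k%:R != 0 :> R by rewrite pnatr_eq0 -lt0n.
apply: (x_irr (q := l%:R / k%:R)); rewrite fmorph_div !rmorph_nat -e.
by rewrite mulrAC divff // mul1r.
Qed.

Let fr_itv k : 0 <= fr k < 1.
Proof.
by have := truncn_itv (kx_ge0 k); rewrite -natr1 /fr => /andP[? ?]; apply/andP; split; lra.
Qed.

Let fr_gt0 k : (0 < k)%N -> 0 < fr k.
Proof.
move=> k0; have /andP[h _] := fr_itv k; rewrite lt_def h andbT.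
by apply/negP; rewrite /fr subr_eq0 => /eqP; exact: natmul_irrational_neq.
Qed.

Let fr_le k (i : nat) : i%:R <= k%:R * x -> fr k <= k%:R * x - i%:R.
Proof.
by rewrite -truncn_ge_nat // => h; rewrite /fr lerD2l lerN2 ler_nat.
Qed.

Let fr_small (eps : R) : 0 < eps -> exists2 k, (0 < k)%N & fr k < eps.
Proof.
move=> eps0; have [J [J0 J1 Jeps]] : exists J : nat, [/\ 0 < J%:R :> R, (0 < J)%N & J%:R^-1 < eps].
  have J0 : 0 < (Num.truncn eps^-1).+1%:R :> R by rewrite ltr0n.
  have Jeps : (Num.truncn eps^-1).+1%:R^-1 < eps by rewrite invf_plt // truncnS_gt.
  by exists (Num.truncn eps^-1).+1; split.
have gJ k : (Num.truncn (J%:R * fr k) < J)%N.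
  have /andP[f0 f1] := fr_itv k; rewrite truncn_lt_nat ?mulr_ge0 ?ler0n //.
  by rewrite -[ltRHS]mulr1 ltr_pM2l.
(* Dirichlet's pigeonhole: two of [J + 1] fractional parts share a box of length [1 / J]. *)
pose g (k : 'I_J.+1) : 'I_J := Ordinal (gJ k).
have /injectivePn[i [j ij /(congr1 val) /= e]] : ~~ injectiveb g.
  by apply/negP => /injectiveP /leq_card; rewrite !card_ord ltnn.
wlog lij : i j ij e / (i < j)%N => [H|].
  have := ij; rewrite -(inj_eq val_inj) neq_ltn => /orP[] lij; first exact: (H i j).
  by apply: (H j i) => //; rewrite eq_sym.
have close : `|fr j - fr i| < J%:R^-1.
  have /andP[fi0 _] := fr_itv i; have /andP[fj0 _] := fr_itv j.
  have := truncn_itv (mulr_ge0 (ltW J0) fi0); have := truncn_itv (mulr_ge0 (ltW J0) fj0).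
  rewrite e -!natr1 => /andP[h1 h2] /andP[h3 h4].
  rewrite -(ltr_pM2l J0) mulfV ?gt_eqF // -{1}(gtr0_norm J0) -normrM ltr_norml.
  by apply/andP; split; lra.
pose p := (j - i)%N; have p0 : (0 < p)%N by rewrite subn_gt0.
pose q := (Num.truncn (j%:R * x) - Num.truncn (i%:R * x))%N.
have dE : fr j - fr i = p%:R * x - q%:R.
  rewrite /fr /p /q !natrB; first by ring.
    by apply: le_truncn; rewrite ler_pM2r // ler_nat ltnW.
  exact: ltnW.
rewrite dE in close; have [h|h] := ltP 0 (p%:R * x - q%:R).
  exists p; first exact: p0.
  have hle : q%:R <= p%:R * x by lra.
  by have := fr_le hle; rewrite gtr0_norm // in close; lra.
(* Here [p * x] falls short of the integer [q] by [z]. With [l] the integer part of [1 / z], the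
   multiple [l * p * x] falls short of [l * q] by [l * z], which exceeds [1 - z] and is at most 1;
   so its fractional part is below [z]. *)
set z := q%:R - p%:R * x.
have z0 : 0 < z.
  have /eqP := natmul_irrational_neq (k := p) (l := q) p0.
  by move=> hne; rewrite /z lt_def subr_eq0 eq_sym hne /=; lra.
have z1 : z < J%:R^-1 by move: close; rewrite ler0_norm // /z; lra.
have J2 : J%:R^-1 <= 1 :> R by rewrite invf_le1 // ler1n.
pose l := Num.truncn z^-1.
have /andP[l1 l2] : l%:R <= z^-1 < l%:R + 1.
  by rewrite natr1; apply: truncn_itv; rewrite invr_ge0 ltW.
have l0 : (0 < l)%N by rewrite truncn_gt0 invf_ge1 //; lra.
have lz1 : l%:R * z <= 1 by rewrite -ler_pdivlMr // mul1r.
have lz2 : 1 < l%:R * z + z by rewrite -{2}[z]mul1r -mulrDl -ltr_pdivrMr // mul1r.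
have q0 : (0 < q)%N.
  by rewrite -(ltr_nat R); move: z0; rewrite /z; have := kx_ge0 p; lra.
exists (l * p)%N; first by rewrite muln_gt0 l0.
have e2 : (l * p)%:R * x - (l * q - 1)%N%:R = 1 - l%:R * z.
  by rewrite natrB ?muln_gt0 ?l0 // !natrM /z; ring.
have hle : (l * q - 1)%N%:R <= (l * p)%:R * x by lra.
have := fr_le hle; rewrite e2; lra.
Qed.

Lemma irrational_schedule (eps : R) (N : nat) : 0 < eps ->
  exists n m eta, [/\ 0 < eta < eps, (N <= n)%N, psum (fun=> x) m = n%:R + eta
    & forall k i : nat, (k < m)%N -> ~~ (i%:R < psum (fun=> x) k < i%:R + eta)].
Proof.
move=> eps0; pose M := (Num.truncn ((N%:R + 1) / x)).+1.
(* No fractional part of the first [M] multiples is below [e]; this forces [m > M] and hence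
   [n >= N]. *)
have [e [e0 ele he]] : exists e, [/\ 0 < e, e <= Num.min eps 1
    & forall k, (0 < k <= M)%N -> e <= fr k].
  elim: M => [|M [e [e0 ele he]]].
    by exists (Num.min eps 1); rewrite lt_min eps0 ltr01; split=> // k; lia.
  exists (Num.min e (fr M.+1)); split.
  - by rewrite lt_min e0 fr_gt0.
  - by rewrite ge_min ele.
  - move=> k; rewrite ge_min; have [->|kM] := eqVneq k M.+1; first by rewrite lexx orbT.
    by move=> ?; rewrite he //; lia.
have exm : exists k, (0 < k)%N && (fr k < e).
  by have [k k0 ke] := fr_small e0; exists k; rewrite k0.
case: (ex_minnP exm) => m /andP[m0 me] m_min.
exists (Num.truncn (m%:R * x)), m, (fr m); split.
- by rewrite fr_gt0 // (lt_le_trans me) // (le_trans ele) // ge_min lexx.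
- have Mm : (M < m)%N.
    by rewrite ltnNge; apply/negP => mM; have := he m; rewrite m0 mM => /(_ isT); lra.
  rewrite truncn_ge_nat // -ler_pdivrMr //.
  have := truncnS_gt ((N%:R + 1) / x); rewrite -/M => h.
  have : M%:R <= m%:R :> R by rewrite ler_nat ltnW.
  suff : N%:R / x <= (N%:R + 1) / x by lra.
  by rewrite ler_pM2r ?invr_gt0 //; lra.
- by rewrite psum_const /fr; ring.
(* Such a left end would have fractional part below [fr m < e], against the minimality of [m]. *)
- move=> k i km; apply/negP; rewrite psum_const => /andP[h1 h2].
  case: k km h1 h2 => [|k] km h1 h2.
    by move: h1; rewrite mul0r ltNge ler0n.
  have := fr_le (ltW h1); have := m_min k.+1; rewrite /=.
  case: (ltP (fr k.+1) e) => [_ /(_ isT)|h _]; [lia|lra].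
Qed.
End IrrationalMultiples.

(** * Schedules for rational weights *)

Lemma bezout_seq (T : Type) (c : nat) (b : T -> nat) (s : seq T) :
  (0 < c)%N -> (forall E, (0 < b E)%N) -> exists w : seq T,
    (\sum_(E <- w) b E)%N = foldr (fun E => gcdn (b E)) c s %[mod c].
Proof.
move=> c0 b0; elim: s => [|E s [w hw]].
  by exists [::]; rewrite big_nil /= mod0n modnn.
set g := foldr _ _ _ in hw; rewrite /= -/g.
have [km kn e _] := egcdnP g (b0 E).
(* Multiplicities cannot be negative; modulo [c], the factor [c - 1] stands for the sign in Bezout's
   identity. *)
exists (nseq km E ++ flatten (nseq (kn * (c - 1)) w)).
rewrite big_cat big_nseq big_flatten big_nseq !iter_addn_0 /=.
have -> : gcdn (b E) g = (kn * c * g + gcdn (b E) g) %[mod c].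
  by rewrite mulnAC modnMDl.
rewrite -modnDmr -modnMml hw modnMml modnDmr; congr (_ %% _)%N.
rewrite mulnC e; case: (c) c0 => // c' _; rewrite subn1 /=; nia.
Qed.

Section RationalSchedule.
Variables (R : realType) (L : finType) (alpha : L -> R) (q : L -> rat).
Hypotheses (alpha_gt0 : forall E, 0 < alpha E) (alphaE : forall E, alpha E = ratr (q E)).

Let c := denom_lcm q.
Let b E := (`|numq (q E)| * (c %/ `|denq (q E)|))%N.

Lemma denom_lcm_gt0 : (0 < c)%N.
Proof.
rewrite /c /denom_lcm; elim/big_ind: _ => // [x y x0 y0|E _].
  by rewrite lcmn_gt0 x0.
by rewrite absz_gt0 denq_neq0.
Qed.

Let cR_gt0 : 0 < c%:R :> R. Proof. by rewrite ltr0n denom_lcm_gt0. Qed.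

Let denq_dvd E : (`|denq (q E)| %| c)%N.
Proof. exact: (biglcmn_sup E). Qed.

Let q_gt0 E : 0 < q E.
Proof. by have := alpha_gt0 E; rewrite alphaE ltr0q. Qed.

Let b_gt0 E : (0 < b E)%N.
Proof.
rewrite muln_gt0 absz_gt0 numq_eq0 gt_eqF //= divn_gt0.
  exact: dvdn_leq denom_lcm_gt0 (denq_dvd E).
by rewrite absz_gt0 denq_neq0.
Qed.

Lemma alpha_denom_lcm E : alpha E = (b E)%:R / c%:R.
Proof.
have nE : `|numq (q E)|%N%:R = (numq (q E))%:~R :> R.
  by rewrite pmulrn gez0_abs // numq_ge0 ltW.
have dE : `|denq (q E)|%N%:R = (denq (q E))%:~R :> R.
  by rewrite pmulrn gez0_abs // denq_ge0.
have d0 : (denq (q E))%:~R != 0 :> R by rewrite intr_eq0 denq_neq0.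
rewrite alphaE /ratr; apply: (canRL (mulfK _)); first by rewrite gt_eqF.
rewrite natrM nE -{1}(divnK (denq_dvd E)) natrM dE.
by field.
Qed.

(** If [g] divides [c] and all [b E], then every denominator, being coprime to its numerator,
    divides [c / g]. So their lcm [c] divides [c / g], and [g = 1]. *)
Lemma gcd_numerators : foldr (fun E => gcdn (b E)) c (enum L) = 1%N.
Proof.
set g := foldr _ _ _.
have [gc gb] : (g %| c)%N /\ forall E, E \in enum L -> (g %| b E)%N.
  rewrite /g; elim: (enum L) => [|E s [IHc IHb]] //=; split.
    exact: dvdn_trans (dvdn_gcdr _ _) IHc.
  move=> F; rewrite inE => /orP[/eqP->|/IHb h]; first exact: dvdn_gcdl.
  exact: dvdn_trans (dvdn_gcdr _ _) h.
have g0 : (0 < g)%N by rewrite lt0n; apply/eqP => g0; move: gc; rewrite g0 dvd0n gtn_eqF ?denom_lcm_gt0.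
suff : (c %| c %/ g)%N.
  move=> /dvdn_leq; rewrite divn_gt0 // dvdn_leq ?denom_lcm_gt0 // => /(_ isT).
  by rewrite leq_divRL // -{2}[c]muln1 leq_pmul2l ?denom_lcm_gt0 //; lia.
rewrite {1}/c; apply/dvdn_biglcmP => E _.
rewrite -(@Gauss_dvdr _ `|numq (q E)|) 1?coprime_sym ?coprime_num_den //.
have /dvdnP[b' b'E] := gb E (mem_enum _ E).
apply/dvdnP; exists b'; apply/eqP; rewrite -(eqn_pmul2r g0) -mulnA divnK //.
by rewrite -mulnA [(_ * g)%N]mulnC mulnA -b'E /b -mulnA divnK // denq_dvd.
Qed.

Lemma rational_schedule (E0 : L) (N K : nat) : exists n m (t : nat -> L),
  [/\ (N <= n)%N, forall k, (k < K)%N -> t k = E0,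
     psum (fun k => alpha (t k)) m = n%:R + 1 / c%:R
   & forall k i : nat, (k < m)%N ->
       ~~ (i%:R < psum (fun k => alpha (t k)) k < i%:R + 1 / c%:R)].
Proof.
have c0 := denom_lcm_gt0.
have [w hw] := bezout_seq (enum L) c0 b_gt0; rewrite gcd_numerators in hw.
(* The leading copies of [E0] add a multiple of [c], so the total stays congruent to 1; their number
   secures the [K] initial copies and [n >= N]. *)
pose s := nseq (c * (N + K).+1) E0 ++ w.
have sumE : (\sum_(E <- s) b E = c * (N + K).+1 * b E0 + \sum_(E <- w) b E)%N.
  by rewrite big_cat big_nseq iter_addn_0 /= [(b E0 * _)%N]mulnC.
set T := (\sum_(E <- s) b E)%N in sumE.
have T0 : (c * (N + K).+1 <= T)%N.
  by rewrite sumE; apply: leq_trans (leq_addr _ _); rewrite leq_pmulr.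
have T1 : (0 < T)%N by apply: leq_trans T0; rewrite muln_gt0 c0.
have /dvdnP[n nE] : (c %| T - 1)%N.
  by rewrite -eqn_mod_dvd // sumE -mulnA mulnC modnMDl hw.
pose t k := nth E0 s k.
have psumE k : psum (fun k => alpha (t k)) k = (\sum_(i < k) b (t i))%N%:R / c%:R.
  rewrite natr_sum mulr_suml; apply: eq_bigr => i _; exact: alpha_denom_lcm.
exists n, (size s), t; split.
- have : (c * N <= c * n)%N by move: T0; rewrite (mulnC c n) -nE mulnS mulnDr; lia.
  by rewrite leq_pmul2l.
- move=> k kK; have kcN : (k < c * (N + K).+1)%N.
    by apply: leq_trans kK _; apply: leq_trans (leq_pmull _ c0); lia.
  by rewrite /t nth_cat size_nseq kcN nth_nseq kcN.
- rewrite psumE (_ : (\sum_(i < size s) b (t i))%N = (n * c + 1)%N).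
    by rewrite natrD natrM mulrDl mulfK // gt_eqF.
  by rewrite -nE subnK // /T (big_nth E0) big_mkord.
- move=> k i _; rewrite psumE; apply/negP => /andP[].
  rewrite ltr_pdivlMr // -natrM ltr_nat => h1.
  rewrite ltr_pdivrMr // mulrDl divfK ?gt_eqF // -natrM natr1 ltr_nat; lia.
Qed.
End RationalSchedule.

(** * Choice of constants and non-isomorphic extensions *)

(** All values of [delta] are integer multiples of [1/c]. This lets A afford the drop
    [eta = 1/c]. *)
Lemma delta_ge_denom_lcm (R : realType) (L : finType) (alpha : L -> R) (q : L -> rat)
    (A : struct L) (X : {set 'I_(sz A)}) :
  (forall E, 0 < alpha E) -> (forall E, alpha E = ratr (q E)) ->
  0 < delta alpha X -> 1 / (denom_lcm q)%:R <= delta alpha X.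
Proof.
move=> alpha0 alphaE; have c0 : 0 < (denom_lcm q)%:R :> R by rewrite ltr0n denom_lcm_gt0.
pose s := (\sum_E `|numq (q E)| * (denom_lcm q %/ `|denq (q E)|) * NE E X)%N.
have -> : delta alpha X = ((#|X| * denom_lcm q)%N%:R - s%:R) / (denom_lcm q)%:R.
  rewrite mulrBl natrM mulfK ?gt_eqF // natr_sum mulr_suml; congr (_ - _).
  by apply: eq_bigr => E _; rewrite [in RHS]natrM {1}(alpha_denom_lcm alpha0 alphaE) mulrAC.
rewrite pmulr_lgt0 ?invr_gt0 // subr_gt0 ltr_nat => h.
by rewrite ler_pM2r ?invr_gt0 // lerBrDr nat1r ler_nat.
Qed.

Lemma exists_coverage_length (R : realType) (a : nat) (x : R) :
  exists K, (a <= K)%N /\ (x < 1 -> a%:R <= K%:R * (1 - x)).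
Proof.
exists (a + (Num.truncn (a%:R / (1 - x))).+1)%N; split=> [|x1]; first exact: leq_addr.
have y0 : 0 < 1 - x by rewrite subr_gt0.
rewrite -ler_pdivrMr // natrD; have := truncnS_gt (a%:R / (1 - x)).
by have := ler0n R a; lra.
Qed.

Lemma exists_scale (R : realType) (L : finType) (alpha : L -> R) :
  (forall E, 0 < alpha E) -> exists d : nat, forall E, 2 <= d%:R * alpha E.
Proof.
move=> alpha0; exists (\max_E (Num.truncn (2 / alpha E)).+1) => E.
rewrite -ler_pdivrMr //; apply: (le_trans (ltW (truncnS_gt _))).
by rewrite ler_nat (leq_bigmax E).
Qed.

(** Each structure is chosen larger than the one before it, so sizes tell them apart. *)
Lemma nonisomorphic_sequence (L : finType) (P : struct L -> Prop) :
  (forall N, exists D, (N < sz D)%N /\ P D) ->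
  exists Ds : nat -> struct L, (forall k, P (Ds k)) /\
    forall i j, i <> j -> ~ isomorphic (Ds i) (Ds j).
Proof.
move=> /choice[F hF]; pose Ds k := iter k.+1 (F \o @sz L) (@Struct L 0 (fun=> set0)).
have Ds_lt i j : (i < j)%N -> (sz (Ds i) < sz (Ds j))%N.
  elim: j => // j IH; rewrite ltnS leq_eqVlt => /orP[/eqP->|/IH h].
    by case: (hF (sz (Ds j))).
  by apply: ltn_trans h _; case: (hF (sz (Ds j))).
exists Ds; split=> [k|i j ij [f [/bij_eq_card]]].
  by case: (hF (sz (iter k (F \o @sz L) (@Struct L 0 (fun=> set0))))).
rewrite !card_ord => e _; case: (ltngtP i j) => // /Ds_lt; by rewrite e ltnn.
Qed.

Theorem theorem3p33 (R : realType) (L : finType) (ar : L -> nat) (alpha : L -> R)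
  (har : forall E : L, (2 <= ar E)%N)
  (halpha : forall E : L, 0 < alpha E <= 1)
  (hnontriv : ~ ((forall E : L, ar E = 2%N) /\ (forall E : L, alpha E = 1)))
  (A : struct L) (hAwf : wf ar A) (hAK : inK alpha A)
  (hApos : 0 < delta alpha (setT : {set 'I_(sz A)})) :
  (~ rational_weights alpha ->
   forall eps : R, 0 < eps ->
   exists Ds : nat -> struct L,
     (forall k : nat, wf ar (Ds k) /\
        exists f : 'I_(sz A) -> 'I_(sz (Ds k)),
          [/\ embedding f,
              essential_minimal_pair alpha (f @: setT)
            & - eps < delta alpha (setT : {set 'I_(sz (Ds k))})
                        - delta alpha (f @: setT) < 0]) /\
     (forall i j : nat, i <> j -> ~ isomorphic (Ds i) (Ds j)))
  /\
  (forall q : L -> rat, (forall E : L, alpha E = ratr (q E)) ->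
   exists Ds : nat -> struct L,
     (forall k : nat, wf ar (Ds k) /\
        exists f : 'I_(sz A) -> 'I_(sz (Ds k)),
          embedding f /\
          essential_minimal_pair alpha (f @: setT) /\
          delta alpha (setT : {set 'I_(sz (Ds k))}) - delta alpha (f @: setT)
            = - (1 / (denom_lcm q)%:R)) /\
     (forall i j : nat, i <> j -> ~ isomorphic (Ds i) (Ds j))).
Proof.
have alpha_gt0 E : 0 < alpha E by case/andP: (halpha E).
have [d d_big] := exists_scale alpha_gt0.
split=> [irr eps eps0|q alphaE].
- have [E0 E0_irr] : exists E0, forall q : rat, alpha E0 <> ratr q.
    apply: contrapT => h; apply: irr => E; apply: contrapT => h'.
    by apply: h; exists E => q e; apply: h'; exists q.
  have E0_lt1 : alpha E0 < 1.
    have /andP[_] := halpha E0; rewrite le_eqVlt => /orP[/eqP e|//].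
    by case: (E0_irr 1); rewrite e rmorph1.
  have [K [K_ge K_big]] := exists_coverage_length (sz A) (alpha E0).
  apply: (@nonisomorphic_sequence L (fun D => wf ar D /\ exists f : 'I_(sz A) -> 'I_(sz D),
    [/\ embedding f, essential_minimal_pair alpha (f @: setT)
      & - eps < delta alpha (setT : {set 'I_(sz D)}) - delta alpha (f @: setT) < 0])) => N.
  (* Besides [eps], the surplus must stay below the length of an edge and below [delta] of A, the
     latter so that D remains in the class. *)
  pose eps' := Num.min eps (Num.min (alpha E0) (delta alpha (setT : {set 'I_(sz A)}))).
  have eps'0 : 0 < eps' by rewrite !lt_min eps0 alpha_gt0.
  have [n [m [eta [/andP[eta0 eta_lt] n_ge psum_m gap]]]] :=
    irrational_schedule (alpha_gt0 E0) E0_irr (N + K + 2 * slack (\max_E ar E) d).+1 eps'0.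
  move: eta_lt; rewrite !lt_min => /and3P[eta_eps eta_alpha eta_delta].
  have [D [szD D_wf [f [f_emb f_emp f_delta]]]] :=
    extension_exists har halpha hAwf hAK hApos (t := fun=> E0) (K := K) eta0
      (fun=> ltW eta_alpha) (ltW eta_delta) psum_m gap d_big ltac:(lia)
      (fun _ _ => erefl) (or_intror E0_lt1) K_ge K_big.
  exists D; split; first by rewrite szD; lia.
  split=> //; exists f; split=> //; rewrite f_delta; apply/andP; split; lra.
(* Nontriviality supplies a symbol whose edges can have a vertex to spare for A: by arity, or by
   weight small enough that some edges do not cross. *)
- have [E0 E0_special] : exists E0, (2 < ar E0)%N \/ alpha E0 < 1.
    apply: contrapT => h; apply: hnontriv; split=> E; apply/eqP.
      rewrite eqn_leq har andbT leqNgt; apply/negP => arE; apply: h.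
      by exists E; left.
    have /andP[_ a1] := halpha E; rewrite eq_le a1 leNgt; apply/negP => aE.
    by apply: h; exists E; right.
  have [K [K_ge K_big]] := exists_coverage_length (sz A) (alpha E0).
  apply: (@nonisomorphic_sequence L (fun D => wf ar D /\ exists f : 'I_(sz A) -> 'I_(sz D),
    embedding f /\ essential_minimal_pair alpha (f @: setT) /\
      delta alpha (setT : {set 'I_(sz D)}) - delta alpha (f @: setT)
        = - (1 / (denom_lcm q)%:R))) => N.
  have [n [m [t [n_ge tE0 psum_m gap]]]] :=
    rational_schedule alpha_gt0 alphaE E0 (N + K + 2 * slack (\max_E ar E) d).+1 K.
  have c0 : 0 < (denom_lcm q)%:R :> R by rewrite ltr0n denom_lcm_gt0.
  have eta_le k : 1 / (denom_lcm q)%:R <= alpha (t k).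
    have := alpha_gt0 (t k); rewrite (alpha_denom_lcm alpha_gt0 alphaE).
    by rewrite pmulr_lgt0 ?invr_gt0 // ltr0n ler_pM2r ?invr_gt0 // ler1n.
  have [D [szD D_wf [f [f_emb f_emp f_delta]]]] :=
    extension_exists har halpha hAwf hAK hApos (K := K) (divr_gt0 ltr01 c0) eta_le
      (delta_ge_denom_lcm alpha_gt0 alphaE hApos) psum_m gap d_big ltac:(lia)
      tE0 E0_special K_ge K_big.
  exists D; split; first by rewrite szD; lia.
  by split=> //; exists f.
Qed.
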